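(* Let $n\ge 1$, let $G\in\mathscr{F}_{n,3}$, and suppose $G'$ is obtained from $G$ by an interchange operation on a nested pair of edges of $G$. Then \[ \operatorname{vol}\mathcal{F}_1(G')\le \operatorname{vol}\mathcal{F}_1(G). \]
   Context: All directed graphs considered have vertex set $[n+1]=\{1,\dots,n+1\}$ and a finite multiset of directed edges $(i,j)$ with $i<j$ (parallel edges allowed, counted with multiplicity). $\mathscr{F}_{n,3}$ denotes the set of such DAGs whose out-degree sequence is $(3,2,2,\dots,2,0)$ and in-degree sequence is $(0,2,2,\dots,2,3)$ (i.e. vertex $1$ has out-degree $3$, vertex $n+1$ has in-degree $3$, and every vertex $2,\dots,n$ has in- and out-degree $2$). A pair of edges $(a,d),(b,c)$ with $a<b<c<d$ is called nested; the interchange operation replaces these two edges by $(a,c),(b,d)$, keeping all other edges. For a DAG $G$ with edge set $E$, the flow polytope is $\mathcal{F}_1(G)=\{f\in\mathbb{R}_{\ge0}^{E}: \text{for each vertex } v,\ \sum_{e\text{ out of }v}f(e)-\sum_{e\text{ into }v}f(e)=a_v\}$ with $(a_1,\dots,a_{n+1})=(1,0,\dots,0,-1)$; it is a lattice polytope and $\operatorname{vol}$ denotes its normalized volume (relative to the lattice in its affine span, a unimodular simplex having volume $1$). *)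

(* Defs.v *)
From mathcomp Require Export all_boot all_order all_algebra.
From mathcomp Require Export all_classical all_reals all_analysis.

Set Implicit Arguments.
Unset Strict Implicit.
Unset Printing Implicit Defensive.

Import Order.TTheory GRing.Theory Num.Theory.

Local Open Scope classical_set_scope.
Local Open Scope ring_scope.

(* The vertex k of {1, ..., n+1} is the ordinal k - 1 : 'I_n.+1. A multiset of
   edges is a sequence taken up to perm_eq; the order of the sequence serves
   only to label the edges (and thus the coordinates of flows). *)
Definition digraph (n : nat) := seq ('I_n.+1 * 'I_n.+1).

Section Digraphs.
Variable n : nat.
Implicit Types (G H : digraph n) (v : 'I_n.+1).

Definition increasing G : bool := all (fun e : 'I_n.+1 * 'I_n.+1 => (e.1 < e.2)%N) G.

Definition outdeg G v : nat := count (fun e => e.1 == v) G.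
Definition indeg G v : nat := count (fun e => e.2 == v) G.

Definition in_F3 G : Prop :=
  [/\ increasing G,
      forall v, outdeg G v =
        (if v == ord0 then 3 else if v == ord_max then 0 else 2)%N &
      forall v, indeg G v =
        (if v == ord0 then 0 else if v == ord_max then 3 else 2)%N].

Definition interchange G G' : Prop :=
  exists (a b c d : 'I_n.+1) H,
    [/\ (a < b)%N, (b < c)%N, (c < d)%N,
        perm_eq G [:: (a, d), (b, c) & H] &
        perm_eq G' [:: (a, c), (b, d) & H]].

End Digraphs.

Section FlowPolytope.
Variables (R : realType) (n : nat).
Implicit Types (G : digraph n) (v : 'I_n.+1).

Definition edge G (e : 'I_(size G)) : 'I_n.+1 * 'I_n.+1 := tnth (in_tuple G) e.

Definition netflow G (f : 'rV[R]_(size G)) v : R :=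
  \sum_(e | (edge e).1 == v) f 0 e - \sum_(e | (edge e).2 == v) f 0 e.

Definition flow_polytope G (a : 'I_n.+1 -> R) : set 'rV[R]_(size G) :=
  [set f : 'rV[R]_(size G) | (forall e, 0 <= f 0 e) /\ (forall v, netflow f v = a v)].

Definition unit_netflow v : R :=
  if v == ord0 then 1 else if v == ord_max then -1 else 0.

Definition flow_polytope1 G : set 'rV[R]_(size G) :=
  flow_polytope unit_netflow.

End FlowPolytope.

Arguments flow_polytope1 R {n} G.

Section Volume.
Variable R : realType.

(* d-dimensional Lebesgue measure as the d-fold product of lebesgue_measure:
   the successor case is the library's formula for the product measure
   (product_measure1), the integral over x of the measure of the x-section. *)
Fixpoint lebesgue_vol (d : nat) : set 'rV[R]_d -> \bar R :=
  match d with
  | 0 => fun A => (\1_A 0)%:E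
  | d'.+1 => fun A =>
      (\int[@lebesgue_measure R]_x
         lebesgue_vol [set y : 'rV[R]_d' | A (row_mx (x%:M : 'M[R]_1) y)])%E
  end.

Definition affine_hull (m : nat) (P : set 'rV[R]_m) : set 'rV[R]_m :=
  [set y | exists k (w : 'I_k -> R) (z : 'I_k -> 'rV[R]_m),
     [/\ forall i, P (z i), \sum_i w i = 1 & y = \sum_i w i *: z i]].

Definition integral_point (m : nat) (x : 'rV[R]_m) : Prop :=
  forall i, x 0 i \is a Num.int.

(* x |-> p + x *m B is an affine bijection from R^d onto the affine span of P
   that carries Z^d onto the lattice of integral points of that span. *)
Definition lattice_chart (m : nat) (P : set 'rV[R]_m) (d : nat)
    (p : 'rV[R]_m) (B : 'M[R]_(d, m)) : Prop :=
  [/\ row_free B,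
      affine_hull P = [set p + x *m B | x in [set: 'rV[R]_d]] &
      forall x : 'rV[R]_d, integral_point (p + x *m B) <-> integral_point x].

(* Two lattice charts of P have the same d and differ by an affine unimodular
   change of variables, so that the value does not depend on the chart. Every
   nonempty lattice polytope has one; the value is 0 if P has no chart. *)
Definition normalized_volume (m : nat) (P : set 'rV[R]_m) : \bar R :=
  xget 0%E [set v | exists d (p : 'rV[R]_m) (B : 'M[R]_(d, m)),
    lattice_chart P p B /\
    v = ((d`!)%:R%:E * lebesgue_vol [set x : 'rV[R]_d | P (p + x *m B)%R])%E].

End Volume.

(* Main.v *)
(** Every cut of G between {1, ..., v} and {v+1, ..., n+1} consists of three
    edges: two edges out of v and one old edge (any third edge out of 1 when
    v = 1, an edge out of some u < v otherwise). Hence G is encoded by a word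
    with one letter per vertex, telling whether the two edges out of v both end
    at v + 1 ("stay": the old edge is kept) or only one does ("move": the other
    one becomes the old edge). Eliminating one edge q v out of each v by the
    cut equations, the flow polytope becomes
    { x >= 0 : x_(v+1) + x_(old v) <= 1 for all v }, and its volume is an
    iterated integral, that is <1, T_1 ... T_n 1>, where T_v is one of
    (D h)(z) = int k(z,t) h(z) dt and (M h)(z) = int k(z,t) h(t) dt, with k the
    indicator of the triangle z, t >= 0, z + t <= 1. Both operators are
    self-adjoint and preserve nonincreasing functions, and <u, M v> <= <u, D v>
    for nonincreasing u and v by Chebyshev's inequality, since
    2 (<u, D v> - <u, M v>) = int k(z,t) (u(z) - u(t)) (v(z) - v(t)) >= 0.
    An interchange only removes edges of the form (v, v+1) and creates none, so
    it can only turn letters D into M. *)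

From HB Require Import structures.
Require Import Defs.
From mathcomp Require Import measurable_realfun ring lra zify.
Set Implicit Arguments.
Unset Strict Implicit.
Unset Printing Implicit Defensive.
Import Order.TTheory GRing.Theory Num.Theory.
Import numFieldNormedType.Exports.
Local Open Scope classical_set_scope.
Local Open Scope ring_scope.

(** * Row vectors with a prepended coordinate *)

Section ConsRow.
Variable R : realType.

Definition cons_rV d (x : R) (y : 'rV[R]_d) : 'rV[R]_d.+1 :=
  row_mx (x%:M : 'M[R]_1) y.

Lemma cons_rV0 d x (y : 'rV[R]_d) : cons_rV x y 0 ord0 = x.
Proof.
have -> : ord0 = lshift d (ord0 : 'I_1) by apply: val_inj.
exact: etrans (row_mxEl _ _ _ _) (mxE _ _ _ _).
Qed.

Lemma cons_rVS d x (y : 'rV[R]_d) i : cons_rV x y 0 (lift ord0 i) = y 0 i.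
Proof.
have -> : lift ord0 i = rshift 1 i by apply: val_inj.
exact: row_mxEr.
Qed.

End ConsRow.

(** * Lebesgue volume under affine maps *)

Section ProductLebesgue.
Variable R : realType.
Context disp (T : measurableType disp) (m : {sigma_finite_measure set T -> \bar R}).

(** Bundled below as a sigma-finite measure, the product can be iterated in [coords_measure]. *)
Definition lebesgue_prod : set (measurableTypeR R * T) -> \bar R :=
  product_measure1 (@lebesgue_measure R) m.

HB.instance Definition _ := Measure.on lebesgue_prod.

Let lebesgue_prod_sigma_finite : sigma_finite setT lebesgue_prod.
Proof.
have := isSigmaFinite.sigma_finiteT
  (lebesgue_integral_fubini.measure_function_Measure_isSigmaFinite__to__measure_function_isSigmaFinite
    (@lebesgue_measure R) m).
exact.
Qed.

HB.instance Definition _ :=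
  Measure_isSigmaFinite.Build _ _ _ lebesgue_prod lebesgue_prod_sigma_finite.

End ProductLebesgue.

Section AffineLebesgue.
Variable R : realType.

Lemma eq_indic (T U : Type) (A : set T) (B : set U) x y :
  (A x <-> B y) -> \1_A x = \1_B y :> R.
Proof.
by move=> AB; rewrite !indicE; case: (boolP (_ \in A)); case: (boolP (_ \in B)) => //;
  rewrite ?inE ?notin_setE ?AB.
Qed.

Local Notation mu := (@lebesgue_measure R).

(** As a function of [A] the left side is a measure that agrees with [mu] on half-open intervals, so
    uniqueness of Lebesgue measure applies. A negative [a] only reflects the interval. *)
Lemma lebesgue_measure_affine (a b : R) (A : set R) : a != 0 -> measurable A ->
  (`|a|%:E * mu [set x : R | A (a * x + b)%R])%E = mu A.
Proof.
move=> a0 mA.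
pose g : measurableTypeR R -> measurableTypeR R := fun x => a * x + b.
have mg : measurable_fun setT g by apply: measurable_funD => //; apply: measurable_funM.
have [nu nuE] : exists nu : {measure set (measurableTypeR R) -> \bar R},
    forall B, nu B = (`|a|%:E * mu (g @^-1` B))%E.
  unshelve eexists (mscale (NngNum (normr_ge0 a)) (pushforward mu g)).
    exact: mg.
  by move=> B.
rewrite -[LHS](nuE A); apply/esym/lebesgue_measure_unique => //= _ [[c d]] _ <-.
rewrite nuE /=.
have [a_gt0|a_lt0] : 0 < a \/ a < 0 by case: ltgtP a0 => //; auto.
  have -> : g @^-1` `]c, d]%classic = `](c - b) / a, (d - b) / a]%classic.
    apply/seteqP; split=> x; rewrite /= !in_itv /= /g ltr_pdivrMr// ler_pdivlMr//;
    by rewrite ltrBlDr lerBrDr ![x * a]mulrC.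
  rewrite !lebesgue_measure_itv/= !lte_fin ltr_pM2r ?invr_gt0// ltrD2r.
  case: ifP => _; last by rewrite mule0.
  rewrite -!EFinB -EFinM gtr0_norm//; congr EFin; field.
  by rewrite gt_eqF.
have -> : g @^-1` `]c, d]%classic = `[(d - b) / a, (c - b) / a[%classic.
  apply/seteqP; split=> x; rewrite /= !in_itv /= /g ltr_ndivlMr// ler_ndivrMr//;
  by rewrite ltrBlDr lerBrDr ![x * a]mulrC andbC.
rewrite !lebesgue_measure_itv/= !lte_fin ltr_nM2r ?invr_lt0// ltrD2r.
case: ifP => _; last by rewrite mule0.
rewrite -!EFinB -EFinM ltr0_norm//; congr EFin; field.
by rewrite lt_eqF.
Qed.

(** By [lebesgue_measure_affine], the pushforward of [mu] under the affine map is [mu] divided by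
    |a|. *)
Lemma ge0_integral_affine (a b : R) (f : R -> \bar R) : a != 0 ->
  measurable_fun setT f -> (forall x, 0 <= f x)%E ->
  (\int[mu]_x f (a * x + b)%R = `|a|^-1%:E * \int[mu]_x f x)%E.
Proof.
move=> a0 mf f0.
pose g : measurableTypeR R -> measurableTypeR R := fun x => a * x + b.
have mg : measurable_fun setT g by apply: measurable_funD => //; apply: measurable_funM.
have na0 : 0 < `|a|^-1 by rewrite invr_gt0 normr_gt0.
pose k := NngNum (ltW na0).
rewrite -(@ge0_integral_mscale _ _ _ mu _ measurableT k f)//.
transitivity (\int[pushforward mu g]_x f x)%E.
  by rewrite ge0_integral_pushforward.
apply: eq_measure_integral => //= A mA _.
rewrite /mscale /= -(lebesgue_measure_affine b a0 mA) muleA -EFinM mulVf ?normr_eq0//.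
by rewrite mul1e.
Qed.

(** The display varies with [d], hence is packed with the type in a dependent pair. *)
Fixpoint coord_space (d : nat) : {disp : measure_display & measurableType disp} :=
  match d with
  | 0 => existT (fun disp => measurableType disp) _ (unit : measurableType _)
  | d'.+1 => existT (fun disp => measurableType disp) _
      ((measurableTypeR R * projT2 (coord_space d'))%type : measurableType _)
  end.

Definition coords d := projT2 (coord_space d).

Fixpoint coords_measure (d : nat) : {sigma_finite_measure set (coords d) -> \bar R} :=
  match d with
  | 0 => (@dirac _ unit tt R : {sigma_finite_measure set unit -> \bar R})
  | d'.+1 => lebesgue_prod (coords_measure d') :
      {sigma_finite_measure set (measurableTypeR R * coords d')%type -> \bar R}
  end.

Fixpoint rV_of_coords (d : nat) : coords d -> 'rV[R]_d :=
  match d with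
  | 0 => fun _ => 0
  | d'.+1 => fun t : (measurableTypeR R * coords d')%type => 
     cons_rV t.1 (rV_of_coords (t.2 : coords d'))
  end.

(* Borel sets, defined without a sigma-algebra on 'rV[R]_d: quantifying over all
   coordinatewise measurable maps makes stability under affine preimages and
   sections immediate. *)
Definition borel_rV d (A : set 'rV[R]_d) : Prop :=
  forall disp (T : measurableType disp) (F : T -> 'rV[R]_d),
    (forall i, measurable_fun setT (fun t => F t 0 i)) -> measurable (F @^-1` A).

Lemma measurable_cons_rV disp (T : measurableType disp) d (f : T -> R)
    (F : T -> 'rV[R]_d) (i : 'I_d.+1) :
  measurable_fun setT f -> (forall j, measurable_fun setT (fun t => F t 0 j)) ->
  measurable_fun setT (fun t => cons_rV (f t) (F t) 0 i).
Proof.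
move=> mf mF; case: (unliftP ord0 i) => [j|] ->.
  rewrite (_ : (fun t => _) = (fun t => F t 0 j)) ?mF//.
  by apply/funext => t; rewrite cons_rVS.
by rewrite (_ : (fun t => _) = f)//; apply/funext => t; rewrite cons_rV0.
Qed.

Lemma measurable_rV_of_coords d (i : 'I_d) :
  measurable_fun setT (fun t : coords d => rV_of_coords t 0 i).
Proof.
elim: d i => [[]//|d IH] /= i.
apply: (@measurable_cons_rV _ (measurableTypeR R * coords d)%type d fst
  (fun t => rV_of_coords (t.2 : coords d))) => [|j]; first exact: measurable_fst.
exact: (measurableT_comp (IH j) measurable_snd).
Qed.

Lemma borel_rV_section d (A : set 'rV[R]_d.+1) x :
  borel_rV A -> borel_rV [set y | A (cons_rV x y)].
Proof.
move=> bA disp T F mF; apply: (bA _ _ (fun t => cons_rV x (F t))) => i.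
exact: (@measurable_cons_rV _ _ _ (cst x)).
Qed.

(** Each step of the recursion is the section formula of a product measure; this makes Tonelli
    available for [lebesgue_vol]. *)
Lemma lebesgue_volE d (A : set 'rV[R]_d) : borel_rV A ->
  lebesgue_vol A = coords_measure d (@rV_of_coords d @^-1` A).
Proof.
elim: d A => [|d IH] A bA /=.
  by rewrite /dirac; congr EFin; exact: eq_indic.
rewrite /lebesgue_prod /product_measure1 /=.
apply: eq_integral => x _ /=; rewrite (IH _ (borel_rV_section x bA)).
congr (coords_measure d _); apply/seteqP; split => t /=;
  by rewrite /xsection /= inE.
Qed.

Lemma borel_rV_affine k d (A : set 'rV[R]_d) u (U : 'M[R]_(k, d)) :
  borel_rV A -> borel_rV [set x | A (u + x *m U)].
Proof.
move=> bA disp T F mF; apply: (bA _ _ (fun t => u + F t *m U)) => i.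
under eq_fun do rewrite !mxE.
apply: measurable_funD => //; apply: measurable_sum => j.
exact: measurable_funM.
Qed.

Lemma measurable_lebesgue_vol_section d (A : set 'rV[R]_d.+1) : borel_rV A ->
  measurable_fun setT (fun x : R => lebesgue_vol [set y | A (cons_rV x y)]).
Proof.
move=> bA.
have mA : measurable (@rV_of_coords d.+1 @^-1` A).
  by apply: bA => i; exact: measurable_rV_of_coords.
have := measurable_fun_xsection (coords_measure d) mA.
apply: eq_measurable_fun => x _ /=.
rewrite (lebesgue_volE (borel_rV_section x bA)).
congr (coords_measure d _); apply/seteqP; split => t /=;
  by rewrite /xsection /= inE.
Qed.

Lemma lebesgue_vol_ge0 d (A : set 'rV[R]_d) : (0 <= lebesgue_vol A)%E.
Proof.
by elim: d A => [|d IH] A /=; [rewrite lee_fin|apply: integral_ge0 => x _].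
Qed.

(* Integrating the first coordinate innermost, as the shear below acts on it. *)
Lemma lebesgue_vol_swap d (A : set 'rV[R]_d.+1) : borel_rV A ->
  lebesgue_vol A = (\int[coords_measure d]_t
    \int[mu]_x (\1_A (cons_rV x (rV_of_coords t)))%:E)%E.
Proof.
move=> bA; rewrite /= -/lebesgue_vol.
have mA : measurable
    [set t : measurableTypeR R * coords d | A (cons_rV t.1 (rV_of_coords t.2))].
  apply: (bA _ _ (fun t : measurableTypeR R * coords d =>
    cons_rV t.1 (rV_of_coords t.2))) => i.
  apply: measurable_cons_rV => [|j]; first exact: measurable_fst.
  exact: (measurableT_comp (measurable_rV_of_coords j) measurable_snd).
rewrite -(fubini_tonelli (m1 := mu) (m2 := coords_measure d)
  (fun t => (\1_A (cons_rV t.1 (rV_of_coords t.2)))%:E)); last first.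
- by move=> t; rewrite lee_fin.
- apply/measurable_EFinP.
  rewrite (_ : (fun t => _) = \1_[set t : measurableTypeR R * coords d |
    A (cons_rV t.1 (rV_of_coords t.2))]); first exact: measurable_indic.
  by apply/funext => t; exact: eq_indic.
apply: eq_integral => x _; have bAx := borel_rV_section x bA.
rewrite (lebesgue_volE bAx).
rewrite (_ : (fun y => _) = (fun y =>
  (\1_(@rV_of_coords d @^-1` [set y | A (cons_rV x y)]) y)%:E)); last first.
  by apply/funext => t; congr EFin; exact: eq_indic.
rewrite integral_indic ?setIT//.
by apply: bAx => i; exact: measurable_rV_of_coords.
Qed.

(** With the other coordinates fixed, the shear translates the first one, which leaves the inner
    integral of [lebesgue_vol_swap] unchanged. *)
Lemma lebesgue_vol_shear d (A : set 'rV[R]_d.+1) (c : 'cV[R]_d) : borel_rV A ->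
  lebesgue_vol [set x : 'rV[R]_(1 + d) | A (x *m block_mx 1%:M 0 c 1%:M)] =
  lebesgue_vol A.
Proof.
move=> bA; set S := [set x | _].
have bS : borel_rV (S : set 'rV[R]_d.+1).
  have := borel_rV_affine (k := 1 + d) 0 (block_mx 1%:M 0 c 1%:M) bA.
  by congr borel_rV; apply/seteqP; split => x /=; rewrite add0r.
rewrite (lebesgue_vol_swap bS) (lebesgue_vol_swap bA).
apply: eq_integral => t _.
have E x : S (cons_rV x (rV_of_coords t)) =
    A (cons_rV (1 * x + (rV_of_coords t *m c) 0 0) (rV_of_coords t)).
  rewrite /S /= /cons_rV mul_row_block mulmx1 mulmx0 add0r mulmx1 mul1r.
  by rewrite raddfD /= -mx11_scalar.
pose f x : \bar R := (\1_A (cons_rV x (rV_of_coords t)))%:E.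
have mf : measurable_fun setT f.
  apply/measurable_EFinP.
  rewrite (_ : (fun t => _) =
    \1_[set x : measurableTypeR R | A (cons_rV x (rV_of_coords t))]).
    apply: measurable_indic.
    apply: (bA _ (measurableTypeR R) (fun x => cons_rV x (rV_of_coords t))) => i.
    exact: measurable_cons_rV.
  by apply/funext => x; exact: eq_indic.
transitivity (\int[mu]_x f (1 * x + (rV_of_coords t *m c) 0 0)%R)%E.
  by apply: eq_integral => x _; congr EFin; apply: eq_indic; rewrite E.
rewrite ge0_integral_affine ?oner_eq0// ?normr1 ?invr1 ?mul1e//.
by move=> x; rewrite lee_fin.
Qed.

(** The first hypothesis is the affine formula one dimension lower. It handles the section over each
    first coordinate; the one-dimensional substitution in that coordinate gives the factor |a|. *)
Lemma lebesgue_vol_ublock d (A : set 'rV[R]_d.+1) (u : 'rV[R]_(1 + d))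
    (a : R) (r : 'rV[R]_d) (D : 'M[R]_d) :
  (forall (v : 'rV[R]_d) (B : set 'rV[R]_d), borel_rV B ->
     lebesgue_vol [set x | B (v + x *m D)] = (`|\det D|^-1%:E * lebesgue_vol B)%E) ->
  a != 0 -> borel_rV A ->
  lebesgue_vol [set x : 'rV[R]_(1 + d) | A (u + x *m block_mx a%:M r 0 D)] =
  ((`|a| * `|\det D|)^-1%:E * lebesgue_vol A)%E.
Proof.
move=> IH a0 bA.
rewrite /= -/lebesgue_vol.
have E x y : u + row_mx x%:M y *m block_mx a%:M r 0 D =
    cons_rV (a * x + lsubmx u 0 0) ((rsubmx u + x *: r) + y *m D).
  rewrite /cons_rV mul_row_block mulmx0 addr0 -{1}[u]hsubmxK add_row_mx.
  congr row_mx; last by rewrite mul_scalar_mx addrA.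
  by rewrite mul_scalar_mx scale_scalar_mx raddfD /= -mx11_scalar addrC [a * x]mulrC.
have cvol x : lebesgue_vol [set y | A (u + row_mx x%:M y *m block_mx a%:M r 0 D)] =
    (`|\det D|^-1%:E * lebesgue_vol [set y | A (cons_rV (a * x + lsubmx u 0%R 0%R) y)])%E.
  rewrite -(IH (rsubmx u + x *: r)); last exact: borel_rV_section.
  by congr lebesgue_vol; apply/seteqP; split => y /=; rewrite E.
transitivity (\int[mu]_x (`|\det D|^-1%:E *
    lebesgue_vol [set y | A (cons_rV (a * x + lsubmx u 0%R 0%R) y)]))%E.
  by apply: eq_integral => x _; exact: cvol.
rewrite ge0_integralZl//; last 2 first.
- have mg : measurable_fun setT (fun x : R => a * x + lsubmx u 0 0).
    by apply: measurable_funD => //; apply: measurable_funM.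
  exact: (measurableT_comp (measurable_lebesgue_vol_section bA) mg).
- by move=> x _; exact: lebesgue_vol_ge0.
rewrite (ge0_integral_affine _ a0 (measurable_lebesgue_vol_section bA)); last first.
  by move=> x; exact: lebesgue_vol_ge0.
by rewrite muleA -EFinM -invfM mulrC.
Qed.

Lemma lebesgue_vol_affine d (U : 'M[R]_d) (u : 'rV[R]_d) (A : set 'rV[R]_d) :
  U \in unitmx -> borel_rV A ->
  lebesgue_vol [set x | A (u + x *m U)] = (`|\det U|^-1%:E * lebesgue_vol A)%E.
Proof.
(* Gaussian elimination: a matrix with nonzero corner is a shear times a block
   upper triangular matrix, and a shear makes the corner nonzero. *)
elim: d U u A => [|d IH] U u A.
  move=> _ _; rewrite det_mx00 normr1 invr1 mul1e; congr lebesgue_vol.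
  by apply/seteqP; split => x /=; rewrite [u + _]thinmx0 [x]thinmx0.
wlog U0 : U u A / U 0 0 != 0 => [wlogU|].
  have [U0|U0] := eqVneq (U 0 0) 0; last exact: wlogU.
  move=> Uu bA.
  have [j Uj] : exists j, U 0 j != 0.
    apply/existsP; rewrite -negb_forall; apply/negP => /forallP U0j.
    move: Uu; rewrite unitmxE (expand_det_row _ 0) big1 ?unitr0// => j _.
    by rewrite (eqP (U0j j)) mul0r.
  case: (unliftP ord0 j) Uj => [k|] -> Uk; last by rewrite U0 eqxx in Uk.
  (* Multiplying [U] by [S] adds column [lift ord0 k] to column 0, so the corner becomes the nonzero
     entry found above. *)
  pose c : 'cV[R]_d := delta_mx k 0.
  pose S : 'M[R]_(1 + d) := block_mx 1%:M 0 c 1%:M.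
  pose S' : 'M[R]_(1 + d) := block_mx 1%:M 0 (- c) 1%:M.
  have SS' : S *m S' = 1%:M.
    rewrite mulmx_block !mulmx1 !mul0mx !mulmx0 !mul1mx !addr0 addrN add0r.
    by rewrite -scalar_mx_block.
  have detS : \det S = 1 by rewrite det_lblock !det1 mulr1.
  (* Pulling [A] back along [S'], the inverse of [S], keeps its volume and compensates for replacing
     [U] by [U *m S]. *)
  have bA' : borel_rV [set y : 'rV[R]_d.+1 | A (0 + y *m (S' : 'M[R]_d.+1))].
    exact: borel_rV_affine.
  rewrite -(lebesgue_vol_shear (- c) bA).
  have -> : [set x | A (u + x *m U)] = [set x : 'rV[R]_d.+1 |
      [set y : 'rV[R]_d.+1 | A (0 + y *m (S' : 'M[R]_d.+1))]
      (u *m (S : 'M[R]_d.+1) + x *m (U *m (S : 'M[R]_d.+1)))].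
    apply/seteqP; split => x /=;
    by rewrite add0r mulmxDl -!mulmxA SS' !mulmx1.
  rewrite wlogU//; last 2 first.
  - have SE i : (S : 'M[R]_d.+1) (lift ord0 i) ord0 = (i == k)%:R.
      have -> : lift ord0 i = rshift 1 i by apply: val_inj.
      have -> : ord0 = lshift d (ord0 : 'I_1) by apply: val_inj.
      by rewrite [LHS](block_mxEdl 1%:M 0 c 1%:M) mxE eqxx andbT.
    rewrite mxE big_ord_recl U0 mul0r add0r (bigD1 k)//= big1 => [|i ik].
      by rewrite SE eqxx mulr1 addr0.
    by rewrite SE (negbTE ik) mulr0.
  - by rewrite unitmxE det_mulmx detS mulr1 -unitmxE.
  rewrite det_mulmx detS mulr1; congr (_ * _)%E.
  by congr lebesgue_vol; apply/seteqP; split => y /=; rewrite add0r.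
move=> Uu bA.
pose V : 'M[R]_(1 + d) := U.
pose r := ursubmx V; pose c := dlsubmx V.
(* [D] is the Schur complement of the corner. *)
pose D := drsubmx V - (U 0 0)^-1 *: (c *m r).
have ul : ulsubmx V = (U 0 0)%:M.
  rewrite [LHS]mx11_scalar !mxE; congr (V _ _)%:M; exact: val_inj.
have UE : V = block_mx 1%:M 0 ((U 0 0)^-1 *: c) 1%:M *m block_mx (U 0 0)%:M r 0 D.
  rewrite mulmx_block !mul1mx !mul0mx !addr0.
  rewrite mul_mx_scalar scalerA mulfV// scale1r -scalemxAl /D addrC subrK.
  by rewrite -ul /r /c submxK.
have detU : \det U = U 0 0 * \det D.
  transitivity (\det V) => //.
  rewrite [in LHS]UE [LHS](det_mulmx (block_mx _ _ _ _)).
  by rewrite (det_lblock 1%:M) (det_ublock (U 0 0)%:M) !det1 !mul1r det_scalar1.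
have Du : D \in unitmx.
  by move: Uu; rewrite !unitmxE !unitfE detU mulf_eq0 negb_or => /andP[].
have -> : [set x | A (u + x *m U)] = [set x : 'rV[R]_d.+1 |
    [set y : 'rV[R]_d.+1 | A (u + y *m block_mx (U 0 0)%:M r 0 D)]
    (x *m block_mx 1%:M 0 ((U 0 0)^-1 *: c) 1%:M)].
  by apply/seteqP; split => x /=; rewrite -mulmxA -UE.
rewrite lebesgue_vol_shear; last exact: borel_rV_affine.
rewrite lebesgue_vol_ublock//; last by move=> v B bB; exact: IH.
by rewrite detU normrM.
Qed.

End AffineLebesgue.
(** * Independence of the normalized volume from the chart *)

Section LatticeCharts.
Variable R : realType.

Lemma integral_point_delta m (i : 'I_m) : integral_point (delta_mx 0 i : 'rV[R]_m).
Proof. by move=> j; rewrite mxE eqxx /=; exact: intr_nat. Qed.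

(** Both charts parametrize the same affine hull, so one factors through the other. The transition
    map sends integral points to integral points; its values at 0 and at the unit vectors show that
    [U] is integral. *)
Lemma lattice_chart_sub m (P : set 'rV[R]_m) d (p : 'rV[R]_m) (B : 'M[R]_(d, m))
    d' (p' : 'rV[R]_m) (B' : 'M[R]_(d', m)) :
  lattice_chart P p B -> lattice_chart P p' B' ->
  exists u U, [/\ p' = p + u *m B, B' = U *m B & forall i j, U i j \is a Num.int].
Proof.
move=> [fB hB iB] [fB' hB' iB'].
have sub x' : exists y, p' + x' *m B' = p + y *m B.
  have : affine_hull P (p' + x' *m B') by rewrite hB'; exists x'.
  by rewrite hB => -[y _ <-]; exists y.
have [u] := sub 0; rewrite mul0mx addr0 => p'E.
have /submxP[U BE] : (B' <= B)%MS.
  apply/row_subP => i; have [y] := sub (delta_mx 0 i).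
  rewrite -rowE p'E -addrA => /addrI /(canRL (addKr _)) ->.
  by rewrite addrC -mulmxBl submxMl.
exists u, U; split => // i j.
have uint x : integral_point x -> integral_point (u + x *m U).
  by move=> /iB'; rewrite {1}p'E BE mulmxA -addrA -mulmxDl => /iB.
have u0 : integral_point u.
  by have := uint 0; rewrite mul0mx addr0; apply => k; rewrite mxE; exact: int_num0.
have /(_ j) := uint _ (integral_point_delta i).
by rewrite mxE -rowE [row i U _ _]mxE => /(rpredB)/(_ (u0 j)); rewrite addrAC subrr add0r.
Qed.

(** The two determinants are nonzero integers with product 1. *)
Lemma normr_det_int_inv d (U V : 'M[R]_d) :
  (forall i j, U i j \is a Num.int) -> (forall i j, V i j \is a Num.int) ->
  U *m V = 1%:M -> `|\det U| = 1.
Proof.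
have det_int (W : 'M[R]_d) : (forall i j, W i j \is a Num.int) -> \det W \is a Num.int.
  by move=> Wi; apply: rpred_sum => s _; rewrite rpredM ?rpredX ?rpredN ?rpred1// rpred_prod.
move=> /det_int Ui /det_int Vi UV1.
have d1 : \det U * \det V = 1 by rewrite -det_mulmx UV1 det1.
have [U0 V0] : \det U != 0 /\ \det V != 0.
  by apply/andP; rewrite -negb_or -mulf_eq0 d1 oner_eq0.
apply/eqP; rewrite eq_le norm_intr_ge1// andbT -(normr1 R) -d1 normrM.
by rewrite ler_peMr// norm_intr_ge1.
Qed.

(** Comparing ranks gives [d' = d]; the transition matrices in the two directions are then mutually
    inverse and integral, so the change of variables preserves volume. *)
Lemma lattice_chart_vol_eq m (P : set 'rV[R]_m) d (p : 'rV[R]_m) (B : 'M[R]_(d, m))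
    d' (p' : 'rV[R]_m) (B' : 'M[R]_(d', m)) :
  borel_rV P -> lattice_chart P p B -> lattice_chart P p' B' ->
  ((d'`!)%:R%:E * lebesgue_vol [set x : 'rV[R]_d' | P (p' + x *m B')%R])%E =
  ((d`!)%:R%:E * lebesgue_vol [set x : 'rV[R]_d | P (p + x *m B)%R])%E.
Proof.
move=> bP cB cB'.
have [u [U [p'E B'E Ui]]] := lattice_chart_sub cB cB'.
have [v [V [_ BE Vi]]] := lattice_chart_sub cB' cB.
have dd' : d' = d.
  case: cB => /eqP rB _ _; case: cB' => /eqP rB' _ _.
  apply/eqP; rewrite -rB -rB' eqn_leq; apply/andP; split; apply: mxrankS.
    by rewrite B'E submxMl.
  by rewrite BE submxMl.
subst d'.
have UV1 : V *m U = 1%:M.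
  case: cB => fB _ _; apply: (row_free_inj fB).
  by rewrite -mulmxA -B'E -BE mul1mx.
have [Vu Uu] := mulmx1_unit UV1.
congr (_ * _)%E.
have -> : [set x | P (p' + x *m B')] =
    [set x | [set y | P (p + y *m B)] (u + x *m U)].
  by apply/seteqP; split => x /=; rewrite mulmxDl -mulmxA -B'E addrA -p'E.
rewrite lebesgue_vol_affine//; last exact: borel_rV_affine.
by rewrite (normr_det_int_inv Ui Vi) ?invr1 ?mul1e//; exact: mulmx1C.
Qed.

Lemma normalized_volumeE m (P : set 'rV[R]_m) d (p : 'rV[R]_m) (B : 'M[R]_(d, m)) :
  borel_rV P -> lattice_chart P p B ->
  normalized_volume P =
  ((d`!)%:R%:E * lebesgue_vol [set x : 'rV[R]_d | P (p + x *m B)%R])%E.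
Proof.
move=> bP cB; rewrite /normalized_volume.
case: xgetP => [v _ [d' [p' [B' [cB' ->]]]]|/(_ _)]; first exact: lattice_chart_vol_eq.
by move=> /(_ _ (ex_intro _ d (ex_intro _ p (ex_intro _ B (conj cB erefl))))).
Qed.

End LatticeCharts.
(** * Two operators on densities of the triangle *)

Section TriangleOperators.
Variable R : realType.
Local Notation mu := (@lebesgue_measure R).
Local Open Scope ereal_scope.

Definition tri (z t : R) : bool := [&& (0 <= z)%R, (0 <= t)%R & (z + t <= 1)%R].

Definition tri_kernel (z t : R) : \bar R := if tri z t then 1 else 0.

Lemma tri_kernelC z t : tri_kernel z t = tri_kernel t z.
Proof.
by rewrite /tri_kernel /tri [(t + z)%R]addrC; case: (_ <= z)%R; case: (_ <= t)%R.
Qed.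

Lemma tri_kernel_ge0 z t : 0 <= tri_kernel z t.
Proof. by rewrite /tri_kernel; case: ifP. Qed.

Lemma measurable_tri_kernel :
  measurable_fun setT (fun p : R * R => tri_kernel p.1 p.2).
Proof.
apply: measurable_fun_ifT => //.
apply: measurable_and; first exact: measurable_fun_ler.
apply: measurable_and; first exact: measurable_fun_ler.
by apply: measurable_fun_ler => //; exact: measurable_funD.
Qed.

Lemma measurable_tri_kernelr z : measurable_fun setT (tri_kernel z).
Proof. exact: (measurableT_comp measurable_tri_kernel (pair1_measurable z)). Qed.

(* Effect of a vertex on densities h of the flow z on the old edge, the two
   other edges of the cut carrying 1 - z in total: stayop when the vertex merges
   these two edges, moveop when it merges one of them with the old edge, the
   remaining one, of flow t, becoming the old edge. *)
Definition stayop (h : R -> \bar R) (z : R) := \int[mu]_t (tri_kernel z t * h z).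
Definition moveop (h : R -> \bar R) (z : R) := \int[mu]_t (tri_kernel z t * h t).

(** Monotonicity is asked only on the half-line [0 <= z]: densities such as [nonneg_density] and the
    images of both operators vanish at negative arguments. *)
Definition nonincreasing_density (h : R -> \bar R) : Prop :=
  [/\ measurable_fun setT h, forall z, 0 <= h z &
      forall z z', (0 <= z)%R -> (z <= z')%R -> h z' <= h z].

Lemma tri_kernel_nonincreasing z z' t :
  (0 <= z)%R -> (z <= z')%R -> tri_kernel z' t <= tri_kernel z t.
Proof.
move=> z0 zz'; rewrite /tri_kernel; case: ifP => [/and3P[_ t0 le1]|_].
  by rewrite /tri z0 t0 (le_trans _ le1)// lerD2r.
by case: ifP.
Qed.

Lemma nonincreasing_density_stay h :
  nonincreasing_density h -> nonincreasing_density (stayop h).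
Proof.
move=> [mh h0 nh]; split.
- apply: (@measurable_fun_fubini_tonelli_F _ _ _ _ _ mu
    (fun p : R * R => tri_kernel p.1 p.2 * h p.1)).
    apply: emeasurable_funM; first exact: measurable_tri_kernel.
    exact: (measurableT_comp mh measurable_fst).
  by move=> p; rewrite mule_ge0// tri_kernel_ge0.
- by move=> z; apply: integral_ge0 => t _; rewrite mule_ge0// tri_kernel_ge0.
- move=> z z' z0 zz'; apply: ge0_le_integral => //.
  + by move=> t _; rewrite mule_ge0// tri_kernel_ge0.
  + by apply: emeasurable_funM => //; exact: measurable_tri_kernelr.
  + by apply: emeasurable_funM => //; exact: measurable_tri_kernelr.
  + move=> t _; apply: lee_pmul; rewrite ?tri_kernel_ge0 ?h0//.
      exact: tri_kernel_nonincreasing.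
    exact: nh.
Qed.

Lemma nonincreasing_density_move h :
  nonincreasing_density h -> nonincreasing_density (moveop h).
Proof.
move=> [mh h0 nh]; split.
- apply: (@measurable_fun_fubini_tonelli_F _ _ _ _ _ mu
    (fun p : R * R => tri_kernel p.1 p.2 * h p.2)).
    apply: emeasurable_funM; first exact: measurable_tri_kernel.
    exact: (measurableT_comp mh measurable_snd).
  by move=> p; rewrite mule_ge0// tri_kernel_ge0.
- by move=> z; apply: integral_ge0 => t _; rewrite mule_ge0// tri_kernel_ge0.
- move=> z z' z0 zz'; apply: ge0_le_integral => //.
  + by move=> t _; rewrite mule_ge0// tri_kernel_ge0.
  + by apply: emeasurable_funM => //; exact: measurable_tri_kernelr.
  + by apply: emeasurable_funM => //; exact: measurable_tri_kernelr.
  + by move=> t _; apply: lee_wpmul2r; rewrite ?h0// tri_kernel_nonincreasing.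
Qed.

Section Pairings.
Variables u v : R -> \bar R.
Hypotheses (gu : nonincreasing_density u) (gv : nonincreasing_density v).

Let mu_ : measurable_fun setT u. Proof. by case: gu. Qed.
Let mv_ : measurable_fun setT v. Proof. by case: gv. Qed.
Let u0 z : 0 <= u z. Proof. by case: gu. Qed.
Let v0 z : 0 <= v z. Proof. by case: gv. Qed.

Lemma integral_stay : \int[mu]_z (u z * stayop v z) =
  \int[mu]_z \int[mu]_t (tri_kernel z t * (u z * v z)).
Proof.
apply: eq_integral => z _; rewrite /stayop -ge0_integralZl//.
- by apply: eq_integral => t _; rewrite muleCA.
- by apply: emeasurable_funM => //; exact: measurable_tri_kernelr.
- by move=> t _; rewrite mule_ge0// tri_kernel_ge0.
Qed.

Lemma integral_move : \int[mu]_z (u z * moveop v z) =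
  \int[mu]_z \int[mu]_t (tri_kernel z t * (u z * v t)).
Proof.
apply: eq_integral => z _; rewrite /moveop -ge0_integralZl//.
- by apply: eq_integral => t _; rewrite muleCA.
- by apply: emeasurable_funM => //; exact: measurable_tri_kernelr.
- by move=> t _; rewrite mule_ge0// tri_kernel_ge0.
Qed.

End Pairings.

Lemma integral_tri_swap (f : R -> R -> \bar R) :
  measurable_fun setT (fun p : R * R => f p.1 p.2) -> (forall z t, 0 <= f z t) ->
  \int[mu]_z \int[mu]_t (tri_kernel z t * f z t) =
  \int[mu]_z \int[mu]_t (tri_kernel z t * f t z).
Proof.
move=> mf f0.
rewrite (fubini_tonelli (m1 := mu) (m2 := mu)
  (fun p : R * R => tri_kernel p.1 p.2 * f p.1 p.2)); last first.
- by move=> p; rewrite mule_ge0// tri_kernel_ge0.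
- by apply: emeasurable_funM => //; exact: measurable_tri_kernel.
by apply: eq_integral => z _; apply: eq_integral => t _; rewrite tri_kernelC.
Qed.

(** Both sides integrate [tri_kernel z t * (u z * v z)]. *)
Lemma stayop_adjoint u v : nonincreasing_density u -> nonincreasing_density v ->
  \int[mu]_z (u z * stayop v z) = \int[mu]_z (stayop u z * v z).
Proof.
move=> gu gv; rewrite (integral_stay gu gv).
under [RHS]eq_integral do rewrite muleC.
rewrite (integral_stay gv gu).
by apply: eq_integral => z _; apply: eq_integral => t _; rewrite [u z * _]muleC.
Qed.

(** The symmetry of the kernel allows [z] and [t] to be exchanged, by Tonelli. *)
Lemma moveop_adjoint u v : nonincreasing_density u -> nonincreasing_density v ->
  \int[mu]_z (u z * moveop v z) = \int[mu]_z (moveop u z * v z).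
Proof.
move=> gu gv; rewrite (integral_move gu gv).
under [RHS]eq_integral do rewrite muleC.
rewrite (integral_move gv gu) (@integral_tri_swap (fun z t => u z * v t)).
- by apply: eq_integral => z _; apply: eq_integral => t _; rewrite [u t * _]muleC.
- case: gu gv => [mu_ _ _] [mv _ _]; apply: emeasurable_funM.
    exact: (measurableT_comp mu_ measurable_fst).
  exact: (measurableT_comp mv measurable_snd).
- by move=> z t; case: gu gv => [_ u0 _] [_ v0 _]; rewrite mule_ge0.
Qed.

(** For finite values this is (a - b)(c - d) >= 0. If [a] or [c] is infinite and neither is 0, the
    right side is infinite; zeros come first because 0 times infinity is 0. *)
Lemma rearrangement_ereal (a b c d : \bar R) : 0 <= b -> b <= a -> 0 <= d -> d <= c ->
  a * d + b * c <= a * c + b * d.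
Proof.
move=> b0 ba d0 dc.
have [a0 c0] : 0 <= a /\ 0 <= c by split; [exact: le_trans ba|exact: le_trans dc].
have [a_eq0|an0] := eqVneq a 0.
  have -> : b = 0 by apply/le_anti; rewrite b0 andbT -a_eq0.
  by rewrite a_eq0 !mul0e.
have [c_eq0|cn0] := eqVneq c 0.
  have -> : d = 0 by apply/le_anti; rewrite d0 andbT -c_eq0.
  by rewrite c_eq0 !mule0.
have ap : 0 < a by rewrite lt_neqAle eq_sym an0.
have cp : 0 < c by rewrite lt_neqAle eq_sym cn0.
have bd0 : b * d != -oo by rewrite gt_eqF// (lt_le_trans ltNy0)// mule_ge0.
have [ay|afin] := eqVneq a +oo; first by rewrite ay (gt0_mulye cp) addye// leey.
have [cy|cfin] := eqVneq c +oo; first by rewrite cy (gt0_muley ap) addye// leey.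
have af : a \is a fin_num by rewrite ge0_fin_numE// ltey.
have cf : c \is a fin_num by rewrite ge0_fin_numE// ltey.
have bf : b \is a fin_num by rewrite ge0_fin_numE// (le_lt_trans ba)// ltey.
have df : d \is a fin_num by rewrite ge0_fin_numE// (le_lt_trans dc)// ltey.
move: ba dc; rewrite -(fineK af) -(fineK bf) -(fineK cf) -(fineK df).
rewrite -!EFinM -!EFinD !lee_fin => ba dc.
by have := @mulr_ge0 _ (fine a - fine b)%R (fine c - fine d)%R; rewrite !subr_ge0; nra.
Qed.

(* Chebyshev's integral inequality on the triangle, whose symmetry turns the
   double of each side into the integral of a symmetric function of (z, t). *)
Lemma le_integral_move_stay u v :
  nonincreasing_density u -> nonincreasing_density v ->
  \int[mu]_z (u z * moveop v z) <= \int[mu]_z (u z * stayop v z).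
Proof.
move=> gu gv; rewrite (integral_move gu gv) (integral_stay gu gv).
case: gu gv => [mu_ u0 nu] [mv v0 nv].
have mu1 := measurableT_comp mu_ (@measurable_fst _ _ R R).
have mu2 := measurableT_comp mu_ (@measurable_snd _ _ R R).
have mv1 := measurableT_comp mv (@measurable_fst _ _ R R).
have mv2 := measurableT_comp mv (@measurable_snd _ _ R R).
have twice f : measurable_fun setT (fun p : R * R => f p.1 p.2) ->
    (forall z t, 0 <= f z t) ->
    \int[mu]_z \int[mu]_t (tri_kernel z t * f z t) +
    \int[mu]_z \int[mu]_t (tri_kernel z t * f z t) =
    \int[mu \x mu]_p (tri_kernel p.1 p.2 * (f p.1 p.2 + f p.2 p.1)).
  move=> mf f0; rewrite [X in _ + X](integral_tri_swap mf f0).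
  have mf' : measurable_fun setT (fun p : R * R => f p.2 p.1).
    apply: (measurableT_comp mf (g := fun p => (p.2, p.1))).
    by apply/measurable_fun_pair; [exact: measurable_snd|exact: measurable_fst].
  have mk := measurable_tri_kernel.
  rewrite -(fubini_tonelli1 (m1 := mu) (m2 := mu)
    (fun p => tri_kernel p.1 p.2 * f p.1 p.2)); last 2 first.
  - exact: emeasurable_funM.
  - by move=> p; rewrite mule_ge0// tri_kernel_ge0.
  rewrite -(fubini_tonelli1 (m1 := mu) (m2 := mu)
    (fun p => tri_kernel p.1 p.2 * f p.2 p.1)); last 2 first.
  - exact: emeasurable_funM.
  - by move=> p; rewrite mule_ge0// tri_kernel_ge0.
  rewrite -ge0_integralD//; last 4 first.
  - by move=> p _; rewrite mule_ge0// tri_kernel_ge0.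
  - exact: emeasurable_funM.
  - by move=> p _; rewrite mule_ge0// tri_kernel_ge0.
  - exact: emeasurable_funM.
  by apply: eq_integral => p _; rewrite ge0_muleDr.
have half (a b : \bar R) : a + a <= b + b -> a <= b.
  by apply: contraTT; rewrite -!ltNge => ba; exact: lteD.
set I := (X in X <= _); set J := (X in _ <= X); apply: half.
have EI : I + I = \int[mu \x mu]_p (tri_kernel p.1 p.2 * (u p.1 * v p.2 + u p.2 * v p.1)).
  apply: (twice (fun z t => u z * v t)); first exact: emeasurable_funM.
  by move=> z t; rewrite mule_ge0.
have EJ : J + J = \int[mu \x mu]_p (tri_kernel p.1 p.2 * (u p.1 * v p.1 + u p.2 * v p.2)).
  apply: (twice (fun z t => u z * v z)); first exact: emeasurable_funM.
  by move=> z t; rewrite mule_ge0.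
clearbody I J; rewrite EI EJ {I J EI EJ}.
apply: ge0_le_integral => //.
- by move=> p _; rewrite mule_ge0 ?tri_kernel_ge0// adde_ge0// mule_ge0.
- apply: emeasurable_funM; first exact: measurable_tri_kernel.
  by apply: emeasurable_funD; exact: emeasurable_funM.
- apply: emeasurable_funM; first exact: measurable_tri_kernel.
  by apply: emeasurable_funD; exact: emeasurable_funM.
move=> [z t] _ /=; rewrite /tri_kernel.
case: ifP => [/and3P[z0 t0 _]|_]; last by rewrite !mul0e.
rewrite !mul1e; have [zt|/ltW tz] := leP z t.
  by apply: rearrangement_ereal => //; [exact: nu|exact: nv].
rewrite addeC [X in _ <= X]addeC.
by apply: rearrangement_ereal => //; [exact: nu|exact: nv].
Qed.

(** * Words in the two operators *)

Fixpoint chain_vol (n : nat) (stay : nat -> bool) : R -> \bar R :=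
  match n with
  | 0 => fun=> 1
  | n'.+1 => if stay 0%N then stayop (chain_vol n' (stay \o succn))
             else moveop (chain_vol n' (stay \o succn))
  end.

Lemma chain_vol_nonincreasing n stay : nonincreasing_density (chain_vol n stay).
Proof.
elim: n stay => [|n IH] stay /=; first by split.
by case: ifP => _; [exact: nonincreasing_density_stay|exact: nonincreasing_density_move].
Qed.

(** Induction on the word for all [u] at once: a common outermost operator is moved onto [u] by
    self-adjointness, and [u] stays nonincreasing. Where only [stay] has D, Chebyshev first turns M
    into D in front of the shorter word of [stay']. *)
Lemma le_integral_chain_vol n (stay stay' : nat -> bool) u :
  nonincreasing_density u -> (forall i, (i < n)%N -> stay' i -> stay i) ->
  \int[mu]_z (u z * chain_vol n stay' z) <= \int[mu]_z (u z * chain_vol n stay z).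
Proof.
elim: n stay stay' u => [//|n IH] stay stay' u gu sub /=.
have IHs w : nonincreasing_density w ->
    \int[mu]_z (w z * chain_vol n (stay' \o succn) z) <=
    \int[mu]_z (w z * chain_vol n (stay \o succn) z).
  by move=> gw; apply: IH => // i ni; exact: sub.
have gh := chain_vol_nonincreasing n (stay \o succn).
have gh' := chain_vol_nonincreasing n (stay' \o succn).
have stay_le : \int[mu]_z (u z * stayop (chain_vol n (stay' \o succn)) z) <=
               \int[mu]_z (u z * stayop (chain_vol n (stay \o succn)) z).
  rewrite (stayop_adjoint gu gh') (stayop_adjoint gu gh).
  by apply: IHs; exact: nonincreasing_density_stay.
have sub0 := sub 0%N isT.
have [s0|s0] := boolP (stay 0%N).
  case: (stay' 0%N); first exact: stay_le.
  exact: le_trans (le_integral_move_stay gu gh') stay_le.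
have /negbTE -> : ~~ stay' 0%N by apply: contra s0.
rewrite (moveop_adjoint gu gh') (moveop_adjoint gu gh).
by apply: IHs; exact: nonincreasing_density_move.
Qed.

End TriangleOperators.
(** * Polytopes of chains of triangle inequalities *)

Section ChainPolytope.
Variable R : realType.
Local Notation mu := (@lebesgue_measure R).

(** Indexing by [nat], with default 0, lets index shifts and [old_index] be used without ordinal
    casts. *)
Definition rV_nth d (y : 'rV[R]_d) (i : nat) : R := oapp (y 0) 0 (insub i).

Lemma rV_nth_ord d (y : 'rV[R]_d) (i : 'I_d) : rV_nth y i = y 0 i.
Proof. by rewrite /rV_nth valK. Qed.

Lemma rV_nth_lt d (y : 'rV[R]_d) i (id : (i < d)%N) : rV_nth y i = y 0 (Ordinal id).
Proof. by rewrite -rV_nth_ord. Qed.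

Lemma rV_nth_cons0 d x (y : 'rV[R]_d) : rV_nth (cons_rV x y) 0 = x.
Proof.
rewrite (rV_nth_lt _ (ltn0Sn d)) -[RHS](cons_rV0 x y).
by congr (cons_rV x y _ _); apply: val_inj.
Qed.

Lemma rV_nth_consS d x (y : 'rV[R]_d) i : rV_nth (cons_rV x y) i.+1 = rV_nth y i.
Proof.
have [id|id] := ltnP i d.
  rewrite (rV_nth_lt y id) (rV_nth_lt _ (id : (i.+1 < d.+1)%N)) -[RHS](cons_rVS x y).
  by congr (cons_rV x y _ _); apply: val_inj.
by rewrite /rV_nth !insubN// -leqNgt.
Qed.

(* The flow on the old edge of the v-th cut when y v is the flow on one of the
   two edges out of the v-th vertex. *)
Fixpoint old_value (stay : nat -> bool) (z : R) (y : nat -> R) (v : nat) : R :=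
  match v with
  | 0 => z
  | v'.+1 => if stay v' then old_value stay z y v' else y v'
  end.

Lemma old_value_shift stay z y v : old_value stay z y v.+1 =
  old_value (stay \o succn) (if stay 0%N then z else y 0%N) (y \o succn) v.
Proof. by elim: v => [//|v IH]; rewrite [LHS]/= -/(old_value stay z y v.+1) IH. Qed.

Definition chain_section n stay z : set 'rV[R]_n :=
  [set y | forall v, (v < n)%N -> tri (old_value stay z (rV_nth y) v) (rV_nth y v)].

Lemma eq_old_value stay z (y y' : nat -> R) :
  y =1 y' -> old_value stay z y =1 old_value stay z y'.
Proof. by move=> yy'; elim=> [//|v IH] /=; rewrite IH yy'. Qed.

Lemma chain_section_cons n stay z t (y : 'rV[R]_n) :
  chain_section stay z (cons_rV t y) <->
  tri z t /\ chain_section (stay \o succn) (if stay 0%N then z else t) y.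
Proof.
have oldE v : old_value stay z (rV_nth (cons_rV t y)) v.+1 =
    old_value (stay \o succn) (if stay 0%N then z else t) (rV_nth y) v.
  rewrite old_value_shift rV_nth_cons0; apply: eq_old_value => i.
  exact: rV_nth_consS.
split=> [S|[S0 S] [_|v vn]].
- split=> [|v vn]; first by have := S 0%N (ltn0Sn _); rewrite rV_nth_cons0.
  by have := S v.+1 vn; rewrite oldE rV_nth_consS.
- by rewrite rV_nth_cons0.
- by rewrite oldE rV_nth_consS; apply: S.
Qed.

Lemma lebesgue_vol_set0 d : lebesgue_vol (set0 : set 'rV[R]_d) = 0%E.
Proof.
elim: d => [|d IH] /=; first by rewrite indicE in_set0.
by apply: integral0_eq => x _; rewrite -[RHS]IH; congr lebesgue_vol; apply/seteqP; split.
Qed.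

(** The section over a first coordinate [t] is empty unless [tri z t]; otherwise it is a shorter
    chain starting from [z] or [t] according to the first letter. Integration over [t] is then
    [stayop] or [moveop]. *)
Lemma lebesgue_vol_chain_section n stay z :
  lebesgue_vol (chain_section (n := n) stay z) = chain_vol n stay z.
Proof.
elim: n stay z => [|n IH] stay z /=.
  by rewrite (_ : chain_section _ _ = setT) ?indicT//; apply/seteqP; split.
transitivity (\int[mu]_t (tri_kernel z t *
    chain_vol n (stay \o succn) (if stay 0%N then z else t)))%E; last first.
  by case: ifP.
apply: eq_integral => t _; rewrite /tri_kernel; case: ifPn => zt.
  rewrite mul1e -IH; congr lebesgue_vol; apply/seteqP; split=> y /=.
    by move=> /chain_section_cons[].
  by move=> Sy; apply/chain_section_cons.
rewrite mul0e -[RHS](lebesgue_vol_set0 n); congr lebesgue_vol.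
by apply/seteqP; split=> y //= /chain_section_cons[]; rewrite (negbTE zt).
Qed.

(** The left factor 1 of the pairing, cut off at negative flows on the first old edge. *)
Definition nonneg_density (z : R) : \bar R := if 0 <= z then 1%E else 0%E.

Lemma nonneg_density_nonincreasing : nonincreasing_density nonneg_density.
Proof.
split.
- apply: measurable_fun_ifT => //; exact: measurable_fun_ler.
- by move=> z; rewrite /nonneg_density; case: ifP.
- by move=> z z' z0 zz'; rewrite /nonneg_density z0 (le_trans z0).
Qed.

(** Coordinate 0 is the flow on the first old edge and coordinate [v.+1] the one on the edge chosen
    at vertex [v], whence the shift by [succn]. *)
Definition chain_polytope n (stay : nat -> bool) : set 'rV[R]_n.+1 :=
  [set x | 0 <= rV_nth x 0 /\
    forall v, (v < n)%N ->
      tri (old_value stay (rV_nth x 0) (rV_nth x \o succn) v) (rV_nth x v.+1)].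

Arguments chain_polytope : clear implicits.

Lemma lebesgue_vol_chain_polytope n stay :
  lebesgue_vol (chain_polytope n stay) =
  (\int[mu]_z (nonneg_density z * chain_vol n stay z))%E.
Proof.
rewrite /= -/lebesgue_vol; apply: eq_integral => z _.
have E y : chain_polytope n stay (cons_rV z y) <-> 0 <= z /\ chain_section stay z y.
  rewrite /chain_polytope /= rV_nth_cons0; split=> -[z0 S]; split=> // v vn;
  have := S v vn; rewrite rV_nth_consS;
  by rewrite (@eq_old_value _ _ (rV_nth (cons_rV z y) \o succn) (rV_nth y))//;
     move=> i; exact: rV_nth_consS.
rewrite /nonneg_density; case: ifPn => z0.
  rewrite mul1e -lebesgue_vol_chain_section; congr lebesgue_vol.
  by apply/seteqP; split => y /=; [move=> /E[]|move=> Sy; apply/E].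
rewrite mul0e -[RHS](lebesgue_vol_set0 n); congr lebesgue_vol.
by apply/seteqP; split => y //= /E[]; rewrite (negbTE z0).
Qed.

Lemma le_lebesgue_vol_chain_polytope n (stay stay' : nat -> bool) :
  (forall i, (i < n)%N -> stay' i -> stay i) ->
  (lebesgue_vol (chain_polytope n stay') <= lebesgue_vol (chain_polytope n stay))%E.
Proof.
move=> sub; rewrite !lebesgue_vol_chain_polytope.
exact: le_integral_chain_vol nonneg_density_nonincreasing sub.
Qed.

End ChainPolytope.

Arguments chain_polytope {R} n stay _.
(** * Sweeping a digraph by cuts of three edges *)

Section SweepLabelling.
Local Open Scope set_scope.
Variables (I : finType) (s t : I -> nat) (n : nat).
Hypotheses (lt_st : forall e, (s e < t e)%N) (le_tn : forall e, (t e <= n)%N).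
Hypotheses (card_out0 : #|[set e | s e == 0%N]| = 3%N).
Hypotheses (card_out : forall v, (0 < v < n)%N -> #|[set e | s e == v]| = 2%N).
Hypotheses (card_in : forall v, (0 < v < n)%N -> #|[set e | t e == v]| = 2%N).

Definition cut v : {set I} := [set e | s e <= v < t e]%N.

Lemma cut0 : cut 0 = [set e | s e == 0%N].
Proof.
apply/finset.setP => e; rewrite !finset.inE leqn0; have := lt_st e.
by case: eqP => //= ->.
Qed.

Lemma in_sub_cut v : [set e | t e == v.+1] \subset cut v.
Proof.
apply/fintype.subsetP => e; rewrite !finset.inE => /eqP te; have := lt_st e.
by rewrite te ltnS ltnSn => ->.
Qed.

Lemma cutS v : cut v.+1 = (cut v :\: [set e | t e == v.+1]) :|: [set e | s e == v.+1].
Proof. by apply/finset.setP => e; rewrite !finset.inE; have := lt_st e; lia. Qed.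

(** Passing an inner vertex removes its two incoming edges from the cut and adds its two outgoing
    ones. *)
Lemma card_cut v : (v < n)%N -> #|cut v| = 3%N.
Proof.
elim: v => [_|v IH vn]; first by rewrite cut0.
rewrite cutS cardsU disjoint_setI0 ?cards0; last first.
  rewrite -finset.setI_eq0; apply/eqP/finset.setP => e; rewrite !finset.inE.
  have := lt_st e; lia.
by rewrite cardsD (finset.setIidPr (in_sub_cut v)) IH ?card_in ?card_out//; lia.
Qed.

(** At the sink, the incoming edges form the whole last cut, which has three edges. *)
Lemma card_in_ge2 v : (v < n)%N -> (1 < #|[set e | t e == v.+1]|)%N.
Proof.
move=> vn; have [vn1|vn1] := ltnP v.+1 n; first by rewrite card_in.
have -> : [set e | t e == v.+1] = cut v; last by rewrite card_cut.
by apply/finset.setP => e; rewrite !finset.inE; have := lt_st e; have := le_tn e; lia.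
Qed.

(** At least two edges of the cut end at [v.+1], while for [v > 0] only one edge of the cut does not
    start at [v]; hence some edge joins [v] to [v.+1]. For [v = 0] the whole cut starts at 0, so
    both edges can be taken to end at 1. *)
Lemma exists_out_pair v : (v < n)%N -> exists pq : I * I,
  [/\ s pq.1 = v, s pq.2 = v, t pq.2 = v.+1, pq.1 != pq.2 & v = 0%N -> t pq.1 = 1%N].
Proof.
case: v => [|v] vn.
  have /card_gt1P[p [q [pin qin pq]]] := card_in_ge2 vn.
  exists (p, q); move: pin qin; rewrite !finset.inE => /eqP tp /eqP tq.
  by split => //=; have := lt_st p; have := lt_st q; lia.
have [q qP] : exists q, q \in [set e | t e == v.+2] :&: [set e | s e == v.+1].
  apply/finset.set0Pn; apply/negP => /eqP int0.
  have sub : [set e | t e == v.+2] \subset cut v.+1 :\: [set e | s e == v.+1].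
    apply/fintype.subsetP => e te.
    rewrite finset.in_setD (fintype.subsetP (in_sub_cut _))// andbT.
    by apply/negP => se; have := finset.in_set0 e; rewrite -int0 finset.in_setI te se.
  have := leq_trans (card_in_ge2 vn) (subset_leq_card sub).
  rewrite cardsD card_cut// (finset.setIidPr _) ?card_out//.
  by apply/fintype.subsetP => e; rewrite !finset.inE; have := lt_st e; lia.
have [p pP] : exists p, p \in [set e | s e == v.+1] :\ q.
  apply/finset.set0Pn; rewrite -card_gt0.
  have := cardsD1 q [set e | s e == v.+1]; rewrite card_out//.
  by have /setIP[_ ->] := qP; lia.
move: qP pP; rewrite !finset.inE => /andP[/eqP tq /eqP sq] /andP[pq /eqP sp].
by exists (p, q).
Qed.

(* The old edge of the v-th cut is the parameter edge of this index: the cut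
   consists of it and of the two chosen edges out of v. *)
Fixpoint old_index (stay : nat -> bool) (v : nat) : nat :=
  match v with
  | 0 => 0
  | v'.+1 => if stay v' then old_index stay v' else v'.+1
  end.

Lemma old_index_le stay v : (old_index stay v <= v)%N.
Proof. by elim: v => [//|v IH] /=; case: ifP => // _; exact: leqW. Qed.

(* P 0, ..., P n are the edges used as coordinates; q v is an edge from v to
   v + 1, whose flow is 1 minus those of the two other edges of the v-th cut. *)
Record sweep (P q : nat -> I) (stay : nat -> bool) : Prop := Sweep {
  sweep_cut : forall v, (v < n)%N ->
    cut v = [set P v.+1; q v; P (old_index stay v)];
  sweep_P_inj : forall i j, (i <= n)%N -> (j <= n)%N -> P i = P j -> i = j;
  sweep_q_inj : forall v w, (v < n)%N -> (w < n)%N -> q v = q w -> v = w;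
  sweep_Pq : forall i v, (i <= n)%N -> (v < n)%N -> P i <> q v;
  sweep_surj : forall e, (exists2 i, (i <= n)%N & e = P i) \/
    (exists2 v, (v < n)%N & e = q v);
  sweep_stay0 : stay 0%N;
  sweep_stay : forall v, (0 < v < n)%N ->
    stay v = (1 < #|[set e | (s e == v) && (t e == v.+1)]|)%N }.

Lemma exists_sweep : (0 < n)%N -> exists P q stay, sweep P q stay.
Proof.
move=> n0.
(* [e0] serves as a default for the pairs chosen at [v >= n]. *)
have [e0 _] : exists e0, e0 \in [set e | s e == 0%N].
  by apply/finset.set0Pn; rewrite -card_gt0 card_out0.
have /choice[pq pqP] : forall v, exists pq : I * I, (v < n)%N ->
    [/\ s pq.1 = v, s pq.2 = v, t pq.2 = v.+1, pq.1 != pq.2 & v = 0%N -> t pq.1 = 1%N].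
  move=> v; case: (ltnP v n) => [vn|_]; last by exists (e0, e0).
  by have [pq pqP] := exists_out_pair vn; exists pq.
have [s10 s20 t20 pq0 /(_ erefl) t10] := pqP 0%N n0.
have [p0 p0P] : exists p0, p0 \in [set e | s e == 0%N] :\: [set (pq 0%N).1; (pq 0%N).2].
  apply/finset.set0Pn; rewrite -card_gt0 cardsD card_out0 (finset.setIidPr _) ?cards2 ?pq0//.
  by apply/fintype.subsetP => e; rewrite !finset.inE => /orP[] /eqP ->; rewrite ?s10 ?s20.
move: p0P; rewrite !finset.inE negb_or => /andP[/andP[p01 p02] /eqP sp0].
(* [P 0] is the third edge out of the source; a letter is [stay] when [P v.+1] ends at [v.+1], as
   [q v] always does. *)
pose P i := if i is v.+1 then (pq v).1 else p0.
pose q v := (pq v).2.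
pose stay v := t (P v.+1) == v.+1.
have PS v : P v.+1 = (pq v).1 by [].
have sP v : (v < n)%N -> s (P v.+1) = v by move=> /pqP[].
have sq v : (v < n)%N -> s (q v) = v by move=> /pqP[].
have P_inj i j : (i <= n)%N -> (j <= n)%N -> P i = P j -> i = j.
  case: i j => [|i] [|j] // iN jN ij.
  - have j0 : j = 0%N by rewrite -(sP j jN) -ij.
    by move: ij p01; rewrite j0 /= => ->; rewrite eqxx.
  - have i0 : i = 0%N by rewrite -(sP i iN) ij.
    by move: ij p01; rewrite i0 /= => ->; rewrite eqxx.
  - by rewrite -(sP i iN) ij sP.
have q_inj v w : (v < n)%N -> (w < n)%N -> q v = q w -> v = w.
  by move=> vn wn vw; rewrite -(sq v vn) vw sq.
have Pq i v : (i <= n)%N -> (v < n)%N -> P i <> q v.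
  case: i => [_ vn iv|i iN vn iv].
    have v0 : v = 0%N by rewrite -(sq v vn) -iv.
    by move: iv p02; rewrite v0 /= => ->; rewrite eqxx.
  have iv' : i = v by rewrite -(sP i iN) iv sq.
  by move: iv; rewrite iv'; have [_ _ _ /eqP] := pqP v vn.
have outE v : (0 < v < n)%N -> [set e | s e == v] = [set P v.+1; q v].
  move=> /andP[v0 vn]; apply/esym/eqP; rewrite eqEcard card_out ?v0// cards2.
  have [spv sqv _ /negbTE pqv _] := pqP v vn; rewrite pqv andbT.
  by apply/fintype.subsetP => e; rewrite !finset.inE => /orP[] /eqP ->; rewrite ?spv ?sqv.
have out0E : [set e | s e == 0%N] = [set P 1%N; q 0%N; P 0%N].
  have card3 : #|[set P 1%N; q 0%N; P 0%N]| = 3%N.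
    by rewrite finset.setUC cardsU1 cards2 !finset.inE negb_or p01 p02 pq0.
  apply/esym/eqP; rewrite eqEcard card_out0 card3 andbT.
  apply/fintype.subsetP => e; rewrite !finset.inE.
  by move=> /orP[/orP[]|] /eqP ->; rewrite ?sp0 ?s10 ?s20.
exists P, q, stay; split => //.
- elim=> [_|v IH vn]; first by rewrite cut0 out0E.
  have {}IH := IH (ltnW vn); have ov := old_index_le stay v.
  rewrite cutS outE// IH.
  have v1n : (0 < v.+1 < n)%N by [].
  have tqv : t (q v) = v.+1 by have [] := pqP v (ltnW vn).
  have in_sub := in_sub_cut v; rewrite IH in in_sub.
  have PvPo : P v.+1 != P (old_index stay v).
    by apply/eqP => /P_inj; lia.
  have qvPo : q v != P (old_index stay v).
    by apply/eqP => /esym/Pq; apply; lia.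
  have Pvqv : P v.+1 != q v by apply/eqP/Pq; lia.
  (* If both chosen edges end at [v.+1], they are all its incoming edges and the old edge
     survives. *)
  rewrite /=; case: ifPn => stv.
    have -> : [set e | t e == v.+1] = [set P v.+1; q v].
      apply/esym/eqP; rewrite eqEcard card_in// cards2 Pvqv andbT.
      apply/fintype.subsetP => e; rewrite !finset.inE.
      by move=> /orP[] /eqP ->; rewrite ?tqv// -/(stay v).
    apply/finset.setP => e; rewrite !finset.inE.
    case: (eqVneq e (P v.+1)) => [->|eP] /=.
      by rewrite (negbTE PvPo) orbF.
    case: (eqVneq e (q v)) => [->|eq] /=; first by rewrite (negbTE qvPo) orbF.
    by rewrite orbC.
  (* Otherwise the two incoming edges, lying in the cut and different from [P v.+1], are [q v] and
     the old edge; [P v.+1] becomes the old edge. *)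
  have -> : [set e | t e == v.+1] = [set q v; P (old_index stay v)].
    apply/eqP; rewrite eqEcard card_in// cards2 qvPo andbT.
    apply/fintype.subsetP => e ein; have := fintype.subsetP in_sub e ein.
    move: ein; rewrite !finset.inE => te /orP[/orP[]|] /eqP eE; rewrite eE ?eqxx ?orbT//.
    by move: stv; rewrite /stay -eE te.
  apply/finset.setP => e; rewrite !finset.inE.
  case: (eqVneq e (q v)) => [->|eq] /=.
    by rewrite [q v == P v.+1]eq_sym (negbTE Pvqv) orbF.
  case: (eqVneq e (P (old_index stay v))) => [->|eP] /=.
    by rewrite [_ == P v.+1]eq_sym (negbTE PvPo) orbF.
  by rewrite !orbF orbC.
- move=> e; have sen : (s e < n)%N := leq_trans (lt_st e) (le_tn e).
  have [se0|se0] := posnP (s e).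
    have : e \in [set e | s e == 0%N] by rewrite finset.inE se0.
    rewrite out0E !finset.inE => /orP[/orP[]|] /eqP ->.
    + by left; exists 1%N.
    + by right; exists 0%N.
    + by left; exists 0%N.
  have : e \in [set e' | s e' == s e] by rewrite finset.inE.
  by rewrite outE ?se0// !finset.inE => /orP[] /eqP eE;
     [left; exists (s e).+1|right; exists (s e)].
- by rewrite /stay /= t10.
- move=> v vn; have /andP[v0 vn'] := vn.
  have [spv sqv tqv pqv _] := pqP v vn'.
  apply/idP/idP => [stv|].
    apply/card_gt1P; exists (P v.+1), (q v); split => //; rewrite !finset.inE.
      by rewrite spv eqxx -/(stay v).
    by rewrite sqv tqv !eqxx.
  move=> /card_gt1P[x [y [xin yin xy]]].
  (* Only [P v.+1] and [q v] leave [v], so an edge to [v.+1] other than [q v] is [P v.+1]. Of two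
     parallel edges, one differs from [q v]. *)
  have two z : z \in [set e | (s e == v) && (t e == v.+1)] -> z != q v -> stay v.
    rewrite !finset.inE => /andP[sz tz] zq.
    have : z \in [set e | s e == v] by rewrite finset.inE.
    by rewrite outE// !finset.inE (negbTE zq) orbF => /eqP zE; rewrite /stay -zE.
  have [xq|xq] := eqVneq x (q v); last exact: two xin xq.
  by apply: (two y yin); rewrite -xq eq_sym.
Qed.

End SweepLabelling.
(** * The flow polytope in coordinates *)

Lemma borel_flow_polytope1 (R : realType) n (G : digraph n) :
  borel_rV (flow_polytope1 R G).
Proof.
move=> disp T F mF.
have msum (p : pred 'I_(size G)) :
    measurable_fun setT (fun t => \sum_(e | p e) F t 0 e).
  rewrite (_ : (fun t => _) = (fun t => \sum_e (if p e then F t 0 e else 0))).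
    by apply: measurable_sum => e; case: (p e).
  by apply/funext => t; rewrite big_mkcond.
have mnet v : measurable_fun setT (fun t => netflow (F t) v).
  exact: measurable_funB.
have -> : F @^-1` flow_polytope1 R G =
    \bigcap_(e in [set: 'I_(size G)]) [set t | 0 <= F t 0 e] `&`
    \bigcap_(v in [set: 'I_n.+1]) [set t | netflow (F t) v = unit_netflow R v].
  apply/seteqP; split => t [F0 Fv]; first by split=> [e _|v _]; [exact: F0|exact: Fv].
  by split=> [e|v]; [exact: F0|exact: Fv].
apply: measurableI; apply: fin_bigcap_measurable => // i _.
  have mb : measurable_fun setT (fun t => 0 <= F t 0 i) by exact: measurable_fun_ler.
  by have := mb measurableT [set true] I; rewrite setTI.
have mb : measurable_fun setT (fun t => netflow (F t) i == unit_netflow R i).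
  exact: measurable_fun_eqr.
have := mb measurableT [set true] I.
by rewrite setTI; congr measurable; apply/seteqP; split => t /= /eqP.
Qed.

(** * Degree conditions as cardinalities of edge sets *)

Section EdgeCounts.
Variables (n : nat) (G : digraph n).

Lemma card_edges (a : pred ('I_n.+1 * 'I_n.+1)) :
  #|[set e : 'I_(size G) | a (edge e)]%SET| = count a G.
Proof. by rewrite -sum1_count big_tnth -sum1_card; apply: eq_bigl => e; rewrite inE. Qed.

Definition source (e : 'I_(size G)) : nat := (edge e).1.
Definition target (e : 'I_(size G)) : nat := (edge e).2.

Lemma card_source v : #|[set e | source e == v]%SET| =
  count (fun e : 'I_n.+1 * 'I_n.+1 => e.1 == v :> nat) G.
Proof. exact: (card_edges (fun e : 'I_n.+1 * 'I_n.+1 => e.1 == v :> nat)). Qed.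

Lemma card_target v : #|[set e | target e == v]%SET| =
  count (fun e : 'I_n.+1 * 'I_n.+1 => e.2 == v :> nat) G.
Proof. exact: (card_edges (fun e : 'I_n.+1 * 'I_n.+1 => e.2 == v :> nat)). Qed.

Lemma target_le e : (target e <= n)%N. Proof. exact: leq_ord. Qed.

Hypothesis hG : in_F3 G.

Lemma source_lt_target e : (source e < target e)%N.
Proof. by case: hG => /allP incG _ _; apply: incG; exact: mem_tnth. Qed.

Lemma card_source0 : #|[set e | source e == 0%N]%SET| = 3%N.
Proof.
by case: hG => _ /(_ ord0) outG _; rewrite card_source; move: outG; rewrite eqxx.
Qed.

Lemma card_source2 v : (0 < v < n)%N -> #|[set e | source e == v]%SET| = 2%N.
Proof.
move=> /andP[v0 vn]; case: hG => _ /(_ (inord v)) outG _; rewrite card_source.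
move: outG; rewrite /outdeg -!val_eqE /= inordK ?ltnS 1?ltnW// gtn_eqF// ltn_eqF// => <-.
by apply: eq_count => e; rewrite -val_eqE /= inordK// ltnS ltnW.
Qed.

Lemma card_target2 v : (0 < v < n)%N -> #|[set e | target e == v]%SET| = 2%N.
Proof.
move=> /andP[v0 vn]; case: hG => _ _ /(_ (inord v)) inG; rewrite card_target.
move: inG; rewrite /indeg -!val_eqE /= inordK ?ltnS 1?ltnW// gtn_eqF// ltn_eqF// => <-.
by apply: eq_count => e; rewrite -val_eqE /= inordK// ltnS ltnW.
Qed.

Lemma exists_edge_sweep : (0 < n)%N ->
  exists P q stay, sweep source target n P q stay.
Proof.
exact: exists_sweep source_lt_target target_le card_source0 card_source2 card_target2.
Qed.

End EdgeCounts.

Section FlowChart.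
Variables (R : realType) (n : nat) (G : digraph n).
Hypotheses (n0 : (0 < n)%N) (hG : in_F3 G).
Local Notation m := (size G).
Local Notation s := (@source n G).
Local Notation t := (@target n G).
Implicit Types f : 'rV[R]_m.

(** The index is one more than that of [cut], so that the empty cut before the source is [k = 0] and
    net flows are differences of consecutive values. *)
Definition cut_flow f (k : nat) : R := \sum_(e | (s e < k <= t e)%N) f 0 e.

Lemma netflow_cut f v : netflow f v = cut_flow f v.+1 - cut_flow f v.
Proof.
rewrite /netflow /cut_flow.
rewrite [X in X - _ = _]big_mkcond [X in _ - X = _]big_mkcond.
rewrite [X in _ = X - _]big_mkcond [X in _ = _ - X]big_mkcond -!sumrB.
apply: eq_bigr => e _; have := source_lt_target hG e.
rewrite -!val_eqE /= -/(source e) -/(target e).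
move: (s e) (t e) (nat_of_ord v) => x y k.
by do 4 case: ifP; rewrite ?subrr ?subr0 ?sub0r//; lia.
Qed.

Lemma cut_flow_cut f v : cut_flow f v.+1 = \sum_(e in cut s t v) f 0 e.
Proof. by apply: eq_bigl => e; rewrite inE ltnS. Qed.

(** The cut flows telescope, starting and ending with empty cuts: they jump to 1 at the source and
    return to 0 at the sink. *)
Lemma unit_netflowP f : (forall v, netflow f v = unit_netflow R v) <->
  (forall v, (v < n)%N -> \sum_(e in cut s t v) f 0 e = 1).
Proof.
have flow0 : cut_flow f 0 = 0 by apply: big_pred0 => e; rewrite ltn0.
have flown : cut_flow f n.+1 = 0.
  by apply: big_pred0 => e; rewrite [X in _ && X]ltnNge target_le andbF.
split=> [netf v vn|cutf v].
  rewrite -cut_flow_cut; elim: v vn => [_|v IH vn].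
    by have := netf ord0; rewrite netflow_cut flow0 subr0 /unit_netflow eqxx.
  have := netf (inord v.+1); rewrite netflow_cut inordK; last by rewrite ltnS ltnW.
  rewrite IH; last exact: ltnW.
  rewrite /unit_netflow -!val_eqE /= inordK; last by rewrite ltnS ltnW.
  by rewrite (ltn_eqF vn) => /eqP; rewrite subr_eq0 => /eqP.
rewrite netflow_cut /unit_netflow -!val_eqE /=; case: ifP => [/eqP->|/eqP/eqP v0].
  by rewrite flow0 cut_flow_cut cutf// subr0.
case: ifP => [/eqP->|/eqP vn].
  by rewrite flown sub0r -(prednK n0) cut_flow_cut cutf// prednK.
have vn' : (v < n)%N by rewrite ltn_neqAle -ltnS ltn_ord andbT; apply/eqP.
rewrite -{2}(prednK (n := v)) ?lt0n// !cut_flow_cut !cutf ?subrr//.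
by rewrite (leq_ltn_trans (leq_pred _)).
Qed.

Variables (P q : nat -> 'I_m) (stay : nat -> bool).
Hypothesis sw : sweep s t n P q stay.
Local Notation old := (old_index stay).

Definition chart_origin : 'rV[R]_m := \row_e \sum_(v < n) (q v == e)%:R.

(** Row [i] puts one unit on [P i] and withdraws it from [q v] for each cut [v] where [P i] is the
    chosen or the old edge. *)
Definition chart_matrix : 'M[R]_(n.+1, m) := \matrix_(i, e)
  ((P i == e)%:R - \sum_(v < n)
     (q v == e)%:R * ((i == v.+1 :> nat)%:R + (i == old v :> nat)%:R)).

Definition chart (x : 'rV[R]_n.+1) : 'rV[R]_m := chart_origin + x *m chart_matrix.

Lemma sum_pick_nat k (x : 'rV[R]_k) j : (j < k)%N ->
  \sum_(i < k) x 0 i * (i == j :> nat)%:R = rV_nth x j.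
Proof.
move=> jk; rewrite (bigD1 (Ordinal jk))//= eqxx mulr1 big1 ?addr0 ?(rV_nth_lt x jk)//.
by move=> i; rewrite -val_eqE /= => /negbTE ->; rewrite mulr0.
Qed.

Lemma chart_P x i : (i <= n)%N -> chart x 0 (P i) = rV_nth x i.
Proof.
move=> iN; rewrite !mxE.
have qP (v : 'I_n) : (q v == P i) = false.
  by apply/eqP => /esym; exact: (sweep_Pq sw).
rewrite big1 ?add0r => [|v _]; last by rewrite qP.
rewrite -(@sum_pick_nat n.+1 x i)//; apply: eq_bigr => j _; rewrite !mxE.
rewrite big1 ?subr0 => [|v _]; last by rewrite qP mul0r.
congr (_ * _%:R); congr nat_of_bool; apply/eqP/eqP => [|->//].
exact: (sweep_P_inj sw (leq_ord j) iN).
Qed.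

Lemma chart_q x v : (v < n)%N ->
  chart x 0 (q v) = 1 - (rV_nth x v.+1 + rV_nth x (old v)).
Proof.
move=> vn; rewrite !mxE.
have qq (w : 'I_n) : (q w == q v) = (w == Ordinal vn).
  rewrite -[w == _]val_eqE /=; apply/eqP/eqP => [|->//].
  exact: (sweep_q_inj sw (ltn_ord w) vn).
have oldn : (old v < n.+1)%N by rewrite ltnS (leq_trans (old_index_le _ _))// ltnW.
rewrite (bigD1 (Ordinal vn))//= eqxx big1 ?addr0 => [|w wv]; last first.
  by rewrite qq (negbTE wv).
congr (1 + _).
rewrite -(@sum_pick_nat n.+1 x v.+1)// -(@sum_pick_nat n.+1 x (old v))//.
rewrite -big_split -sumrN; apply: eq_bigr => i _; rewrite mxE.
have -> : (P i == q v) = false by apply/eqP; apply: (sweep_Pq sw); rewrite // -ltnS.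
rewrite (bigD1 (Ordinal vn))//= eqxx big1 ?addr0 => [|w wv]; last first.
  by rewrite qq (negbTE wv) mul0r.
by rewrite mul1r sub0r mulrN mulrDr.
Qed.

Lemma cut_sum f v : (v < n)%N -> \sum_(e in cut s t v) f 0 e =
  f 0 (q v) + (f 0 (P v.+1) + f 0 (P (old v))).
Proof.
move=> vn; have oldv := old_index_le stay v.
rewrite (sweep_cut sw vn) finset.setUC big_setU1 ?big_setU1 ?big_set1 //=.
- by ring.
- by rewrite !inE; apply/eqP; apply: (sweep_Pq sw).
- rewrite !inE negb_or; apply/andP; split; apply/eqP.
    by move=> /(sweep_P_inj sw); lia.
  by apply: (sweep_Pq sw) => //; lia.
Qed.

Lemma chart_cut x v : (v < n)%N -> \sum_(e in cut s t v) chart x 0 e = 1.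
Proof.
move=> vn; have oldv := old_index_le stay v.
by rewrite cut_sum// chart_q// !chart_P ?subrK//; lia.
Qed.

Lemma cut_chart f : (forall v, (v < n)%N -> \sum_(e in cut s t v) f 0 e = 1) ->
  f = chart (\row_i f 0 (P i)).
Proof.
move=> cutf.
have nthE i : (i <= n)%N -> rV_nth (\row_(j < n.+1) f 0 (P j)) i = f 0 (P i).
  by move=> iN; rewrite (rV_nth_lt _ (iN : (i < n.+1)%N)) mxE.
apply/rowP => e; case: (sweep_surj sw e) => [[i iN ->]|[v vn ->]].
  by rewrite chart_P// nthE.
have oldv := old_index_le stay v.
rewrite chart_q// !nthE//; last by lia.
by rewrite -(cutf v vn) cut_sum// addrK.
Qed.

Lemma old_value_index (x : 'rV[R]_n.+1) v : (v <= n)%N ->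
  old_value stay (rV_nth x 0) (rV_nth x \o succn) v = rV_nth x (old v).
Proof. by elim: v => [//|v IH] vn /=; rewrite IH ?(ltnW vn)//; case: ifP. Qed.

(** A chart point satisfies the cut equations automatically. Nonnegativity on the edges [P i] and
    [q v] amounts to the triangle inequalities. *)
Lemma flow_polytope_chart x :
  flow_polytope1 R G (chart x) <-> chain_polytope n stay x.
Proof.
have netx : forall v, netflow (chart x) v = unit_netflow R v.
  by apply/unit_netflowP => v; exact: chart_cut.
split=> [[x0 _]|[x0 S]].
  split=> [|v vn]; first by rewrite -chart_P.
  have oldv := old_index_le stay v.
  rewrite /tri old_value_index ?(ltnW vn)//= -!chart_P ?x0//=; last by lia.
  have := x0 (q v); rewrite chart_q// !chart_P//; last by lia.
  by rewrite subr_ge0 addrC.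
have Sv v : (v < n)%N ->
    [/\ 0 <= rV_nth x (old v), 0 <= rV_nth x v.+1 & rV_nth x (old v) + rV_nth x v.+1 <= 1].
  by move=> vn; have := S v vn; rewrite old_value_index ?(ltnW vn)// => /and3P[].
split=> // e; case: (sweep_surj sw e) => [[[|i] iN ->]|[v vn ->]].
- by rewrite chart_P.
- by rewrite chart_P//; have [] := Sv i iN.
- by rewrite chart_q// subr_ge0 addrC; have [] := Sv v vn.
Qed.

(* The constant point 1/3 is interior to the polytope, which is therefore full
   dimensional. *)
Lemma chart_third_interior (x : 'rV[R]_n.+1) : exists2 k : R, k != 0 &
  chain_polytope n stay (const_mx 3^-1 + k^-1 *: (x - const_mx 3^-1)).
Proof.
pose M := 1 + \sum_i `|x 0 i - 3^-1|.
have S0 : 0 <= \sum_i `|x 0 i - 3^-1| by exact: sumr_ge0.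
have M0 : 0 < M by rewrite /M; lra.
(* Each deviation from 1/3 is at most [M], hence at most 1/6 after scaling: all coordinates lie in
   [1/6, 1/2], and any two sum to at most 1. *)
exists (6 * M); first by rewrite mulf_neq0// gt_eqF.
set y := _ + _.
have yE i : (i <= n)%N -> 6^-1 <= rV_nth y i <= 2^-1.
  move=> iN; rewrite (rV_nth_lt y (iN : (i < n.+1)%N)) !mxE.
  set d := x 0 _ - _.
  have dM : `|d| <= M.
    rewrite /M (bigD1 (Ordinal (iN : (i < n.+1)%N)))//= addrCA lerDl.
    by rewrite addr_ge0// sumr_ge0.
  have : `|(6 * M)^-1 * d| <= 6^-1.
    rewrite normrM ger0_norm ?invr_ge0; last by lra.
    by rewrite invfM -mulrA ger_pMr ?invr_gt0// mulrC ler_pdivrMr ?mul1r.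
  by rewrite ler_norml; lra.
split=> [|v vn]; first by have := yE 0%N isT; lra.
have oldv := old_index_le stay v.
rewrite old_value_index ?(ltnW vn)//=.
have := yE v.+1 vn; have := yE (old v) (leq_trans oldv (ltnW vn)).
by move=> ? ?; apply/and3P; split; lra.
Qed.

Lemma chart_affine x y (k : R) : k != 0 ->
  chart y = (1 - k) *: chart x + k *: chart (x + k^-1 *: (y - x)).
Proof.
move=> k0; rewrite /chart mulmxDl -scalemxAl mulmxBl.
move: (x *m _) (y *m _) => u v; apply/rowP => e; rewrite !mxE; by field.
Qed.

Lemma integral_rV_nth d (x : 'rV[R]_d) i :
  integral_point x -> rV_nth x i \is a Num.int.
Proof.
move=> xi; have [id|id] := ltnP i d; first by rewrite (rV_nth_lt x id).
by rewrite /rV_nth insubF ?rpred0 ?ltnNge ?id.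
Qed.

(** The parameters are the flows on the [P i], which gives injectivity; the remaining flows are
    affine in them with integer coefficients, which gives the lattice condition. *)
Lemma chart_lattice : lattice_chart (flow_polytope1 R G) chart_origin chart_matrix.
Proof.
split.
- apply: inj_row_free => x xB; apply/rowP => i.
  have E : chart x = chart 0 by rewrite /chart xB mul0mx.
  by rewrite -(rV_nth_ord x) -(rV_nth_ord 0) -!chart_P ?leq_ord// E.
- apply/seteqP; split=> [y [k [w [z [Pz w1 ->]]]]|y [x _ <-]] /=.
    exists (\row_i (\sum_j w j *: z j) 0 (P i)) => //; apply/esym/cut_chart => v vn.
    transitivity (\sum_(e in cut s t v) \sum_j w j * z j 0 e).
      by apply: eq_bigr => e _; rewrite summxE; apply: eq_bigr => j _; rewrite mxE.
    rewrite exchange_big /= -w1; apply: eq_bigr => j _.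
    have [_ /unit_netflowP cutz] := Pz j.
    by rewrite -mulr_sumr cutz// mulr1.
  (* The chart point is an affine combination, with weights [1 - k] and [k], of the images of the
     centre and of a point [x'] close to it, both in the polytope. *)
  have [k k0 yP] := chart_third_interior x.
  set x' := _ + _ in yP.
  have x0P : chain_polytope n stay (const_mx 3^-1 : 'rV[R]_n.+1).
    have [k' _] := chart_third_interior (const_mx 3^-1).
    by rewrite subrr scaler0 addr0.
  exists 2%N, (fun i : 'I_2 => if i == 0 then 1 - k else k),
    (fun i : 'I_2 => if i == 0 then chart (const_mx 3^-1) else chart x'); split.
  + by move=> i; case: ifP => _; apply/flow_polytope_chart.
  + by rewrite !big_ord_recl big_ord0 /=; ring.
  + rewrite !big_ord_recl big_ord0 /= addr0; exact: chart_affine.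
- move=> x; rewrite -/(chart x); split=> xint.
    by move=> i; rewrite -rV_nth_ord -chart_P ?leq_ord.
  move=> e; case: (sweep_surj sw e) => [[i iN ->]|[v vn ->]].
    by rewrite chart_P// integral_rV_nth.
  by rewrite chart_q// rpredB ?rpred1// rpredD// integral_rV_nth.
Qed.

Lemma normalized_volume_flow_polytope1 : normalized_volume (flow_polytope1 R G) =
  (((n.+1)`!)%:R%:E * lebesgue_vol (chain_polytope n stay : set 'rV[R]_n.+1))%E.
Proof.
rewrite (normalized_volumeE (@borel_flow_polytope1 R n G) chart_lattice).
congr (_ * lebesgue_vol _)%E.
by apply/seteqP; split=> x /= /flow_polytope_chart.
Qed.

End FlowChart.

(** * Comparison of two digraphs through their edges between consecutive vertices *)

Definition unit_edge n (v : nat) (e : 'I_n.+1 * 'I_n.+1) : bool :=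
  (e.1 == v :> nat) && (e.2 == v.+1 :> nat).

(** Both polytopes become chain polytopes of dimension [n.+1]. Their letters agree at vertex 0;
    elsewhere a letter is [stay] exactly when the edge to the next vertex is multiple. *)
Lemma le_normalized_volume_flow_polytope1 (R : realType) n (G G' : digraph n) :
  (0 < n)%N -> in_F3 G -> in_F3 G' ->
  (forall v : nat, (count (unit_edge v) G' <= count (unit_edge v) G)%N) ->
  (normalized_volume (flow_polytope1 R G') <= normalized_volume (flow_polytope1 R G))%E.
Proof.
move=> n0 hG hG' le_short.
have [P [q [stay sw]]] := exists_edge_sweep hG n0.
have [P' [q' [stay' sw']]] := exists_edge_sweep hG' n0.
rewrite (normalized_volume_flow_polytope1 R n0 hG sw).
rewrite (normalized_volume_flow_polytope1 R n0 hG' sw').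
apply: lee_wpmul2l; first by rewrite lee_fin.
apply: le_lebesgue_vol_chain_polytope => -[|i] iN.
  by rewrite (sweep_stay0 sw).
rewrite (sweep_stay sw)// (sweep_stay sw')//.
rewrite (card_edges G (@unit_edge n i.+1)) (card_edges G' (@unit_edge n i.+1)).
by move=> short'; exact: leq_trans short' (le_short i.+1).
Qed.

(** The tails [a], [b] and the heads [c], [d] are only paired differently. *)
Lemma interchange_in_F3 n (G G' : digraph n) :
  in_F3 G -> interchange G G' -> in_F3 G'.
Proof.
move=> [incG outG inG] [a [b [c [d [H [ab bc cd permG permG']]]]]].
have /permP GE := permG; have /perm_mem GE' := permG.
have /permP G'E := permG'; have /perm_mem G'E' := permG'.
split.
- apply/allP => e; rewrite G'E' !inE => /or3P[/eqP->|/eqP->|eH] /=.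
  + exact: ltn_trans bc.
  + exact: ltn_trans cd.
  + by move/allP : incG; apply; rewrite GE' !inE eH !orbT.
- by move=> v; rewrite -outG /outdeg G'E GE.
- by move=> v; rewrite -inG /indeg G'E GE /= addnCA.
Qed.

Theorem theorem4p19 (R : realType) (n : nat) (hn : (1 <= n)%N)
    (G G' : digraph n) (hG : in_F3 G) (hGG' : interchange G G') :
  (normalized_volume (flow_polytope1 R G')
     <= normalized_volume (flow_polytope1 R G))%E.
Proof.
apply: le_normalized_volume_flow_polytope1 => //; first exact: interchange_in_F3 hGG'.
move=> v; case: hGG' => a [b [c [d [H [ab bc cd /permP GE /permP G'E]]]]].
rewrite GE G'E /= /unit_edge /=.
(* The new edges jump over [b] and [c] respectively, so neither joins consecutive vertices. *)
have -> : (a == v :> nat) && (c == v.+1 :> nat) = false by lia.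
have -> : (b == v :> nat) && (d == v.+1 :> nat) = false by lia.
by rewrite !add0n addnA leq_addl.
Qed.
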